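(* Let $G$ be a finite solvable permutation group on a set $\Omega$ that is elusive on $\Omega$, $2$-closed on $\Omega$, and has fixity $f$. Then $f\geq 6$.
   Context: A permutation group $G\leq \mathrm{Sym}(\Omega)$ has fixity $f$ if no non-trivial element of $G$ fixes more than $f$ points of $\Omega$, and some non-trivial element of $G$ fixes exactly $f$ points. (In particular, a group of fixity $f$ is non-trivial.) A transitive permutation group $G\leq\mathrm{Sym}(\Omega)$ is called elusive on $\Omega$ if it contains no fixed-point-free element (on $\Omega$) of prime order. The $2$-closure $G^{(2),\Omega}$ of $G$ is the largest subgroup of $\mathrm{Sym}(\Omega)$ whose orbits on $\Omega\times\Omega$ are the same as the orbits of $G$ on $\Omega\times\Omega$; $G$ is $2$-closed on $\Omega$ if $G=G^{(2),\Omega}$. *)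

(* Defs.v *)
From mathcomp Require Import all_boot all_fingroup all_solvable.

Set Implicit Arguments.
Unset Strict Implicit.
Unset Printing Implicit Defensive.

Local Open Scope group_scope.

Section PermutationGroups.

Variable T : finType.
Implicit Types (G H K : {group {perm T}}) (g : {perm T}).

Definition has_fixity G (f : nat) : Prop :=
  (forall g, g \in G -> g != 1 -> #|'Fix_'P[g]| <= f) /\
  (exists g, [/\ g \in G, g != 1 & #|'Fix_'P[g]| = f]).

Definition elusive G : Prop :=
  [transitive G, on [set: T] | 'P] /\
  ~ (exists g, [/\ g \in G, prime #[g] & 'Fix_'P[g] = set0]).

Definition pair_act (p : T * T) g : T * T := (g p.1, g p.2).

Lemma pair_act1 : pair_act^~ 1 =1 id.
Proof. by case=> x y; rewrite /pair_act !perm1. Qed.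

Lemma pair_actM p : act_morph pair_act p.
Proof. by case: p => x y g h; rewrite /pair_act !permM. Qed.

Definition pair_action : {action {perm T} &-> T * T} :=
  TotalAction pair_act1 pair_actM.

Definition orbitals G : {set {set T * T}} :=
  orbit pair_action G @: [set: T * T].

(* K is the 2-closure of G: the largest subgroup, not merely a maximal one. *)
Definition is_two_closure G K : Prop :=
  orbitals K = orbitals G /\
  (forall H, orbitals H = orbitals G -> H \subset K).

Lemma two_closure_exists G : exists K, is_two_closure G K.
Proof.
pose S := [set g | [forall p, pair_act p g \in orbit pair_action G p]].
have gS : group_set S.
  apply/group_setP; split=> [|g h].
    by rewrite inE; apply/forallP=> p; rewrite pair_act1 orbit_refl.
  rewrite !inE => /forallP Sg /forallP Sh; apply/forallP=> p.
  by rewrite pair_actM; exact: (orbit_trans (Sh _) (Sg p)).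
have sGS : G \subset S.
  by apply/subsetP=> g Gg; rewrite inE; apply/forallP=> p; exact: mem_orbit.
have orbS p : orbit pair_action S p = orbit pair_action G p.
  apply/eqP; rewrite eqEsubset; apply/andP; split; last exact: imsetS.
  by apply/subsetP=> _ /imsetP[g Sg ->]; move: Sg; rewrite inE => /forallP; exact.
exists (Group gS); split=> [|H eqHG]; first by apply: eq_imset => p; exact: orbS.
apply/subsetP=> g Hg; rewrite inE; apply/forallP=> p.
have: orbit pair_action H p \in orbitals G by rewrite -eqHG imset_f.
case/imsetP=> q _ eqHq.
have Gp : p \in orbit pair_action G q by rewrite -eqHq orbit_refl.
by rewrite (orbit_eqP Gp) -eqHq; exact: mem_orbit.
Qed.

Definition two_closed G : Prop := is_two_closure G G.

End PermutationGroups.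

(* Main.v *)
(** Let [N] be a minimal normal subgroup of [G], an elementary abelian [p]-group,
    and suppose [f <= 5].  By elusiveness a nontrivial element of [N] fixes a
    point, hence a whole [N]-orbit, so the common size [q] of the [N]-orbits is
    at most 5.  Any two point stabilizers [N_a], [N_b] are then either equal or
    satisfy [N_a N_b = N].  This is clear if [q] is prime.  If [q = 4], nontrivial
    elements fix exactly one orbit, so distinct stabilizers meet trivially and
    [#|N| <= 16]; order 16 is fine, while order 8 forces 28 points, and then an
    element of order 7 fixes a multiple of 7 points, hence none.
    Choose [h w] in [N] outside [N_w], depending on [N_w] only.  By the
    dichotomy the permutation [w |-> h w w] agrees on each pair of points with an
    element of [N], so it lies in the 2-closure; it is a derangement of order [p]. *)
Require Import Defs.
From mathcomp Require Import all_boot all_fingroup all_solvable.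

Set Implicit Arguments.
Unset Strict Implicit.
Unset Printing Implicit Defensive.

Local Open Scope group_scope.

Section SmallFixity.

Variable T : finType.
Implicit Types (G N : {group {perm T}}) (g x : {perm T}) (a b w : T).

(** Agreeing on every pair with some element of [G], [g] preserves each [G]-orbit on pairs;
    adjoining it to [G] changes no orbital, and maximality of the 2-closure applies. *)
Lemma two_closed_mem G g :
    two_closed G -> (forall a b, exists2 y, y \in G & y a = g a /\ y b = g b) ->
  g \in G.
Proof.
case=> _ maxG locG; suff /maxG/subsetP : orbitals <<g |: G>>%G = orbitals G.
  by apply; rewrite mem_gen // setU11.
have sGH : G \subset <<g |: G>> by rewrite sub_gen ?subsetUr.
apply: eq_imset => p; apply/eqP; rewrite eqEsubset andbC imsetS //=.
rewrite acts_sub_orbit ?orbit_refl // gen_subG subUset acts_orbit ?subsetT //.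
rewrite andbT sub1set !inE; apply/subsetP=> -[a b] Gab; rewrite inE /=.
have [y Gy [ya yb]] := locG a b.
have -> : pair_act (a, b) g = pair_action T (a, b) y.
  by rewrite /= /pair_act /= ya yb.
exact: orbit_trans (mem_orbit _ _ Gy) Gab.
Qed.

Lemma astab1_abelian_act N x w :
  abelian N -> x \in N -> 'C_N[x w | 'P] = 'C_N[w | 'P].
Proof.
move=> abN Nx; have /= -> := astab1_act (perm_action T) w x.
rewrite -{1}(conjGid Nx) -conjIg; apply: normP.
by apply: subsetP Nx; rewrite sub_abelian_norm ?subsetIl.
Qed.

Lemma two_closed_derangement G N p :
    two_closed G -> N \subset G -> prime p -> p.-abelem N ->
    (forall w, ~~ (N \subset 'C[w | 'P])) ->
    (forall a b, 'C_N[a | 'P] = 'C_N[b | 'P]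
                 \/ N \subset 'C_N[a | 'P] * 'C_N[b | 'P]) ->
  T -> exists g, [/\ g \in G, prime #[g] & 'Fix_'P[g] = set0].
Proof.
move=> clG sNG p_pr abelN ntN dichN w0.
have abN := abelem_abelian abelN.
(* [repr] chooses from a set, so points with equal stabilizers receive the same element. *)
pose h w := repr (N :\: 'C_N[w | 'P]).
have hP w : h w \in N :\: 'C_N[w | 'P].
  have /subsetPn[x Nx nx] := ntN w.
  by apply: (mem_repr x); rewrite in_setD in_setI Nx (negPf nx).
have Nh w : h w \in N by have /setDP[] := hP w.
have hE a b : 'C_N[a | 'P] = 'C_N[b | 'P] -> h a = h b by rewrite /h => ->.
have Ch a : 'C_N[h a a | 'P] = 'C_N[a | 'P] by exact: astab1_abelian_act.
(* By [Ch], the stabilizer of [w], hence [h w], can be recovered from the image [h w w]. *)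
have inj_g : injective (fun w => h w w).
  move=> a b eqg; have := Ch a; rewrite eqg Ch => /hE eqh.
  by apply: (@perm_inj _ (h a)); rewrite eqg eqh.
pose g : {perm T} := perm inj_g.
have gX n w : (g ^+ n) w = (h w ^+ n) w.
  elim: n w => [|n IHn] w; first by rewrite !expg0 !perm1.
  by rewrite !expgS !permM IHn permE (hE _ _ (Ch w)).
have fixg w : g w != w.
  rewrite permE; have := hP w; rewrite !inE (Nh w) andbT /=.
  by apply: contraNneq => ehw; rewrite sub1set inE /= /aperm ehw.
exists g; split.
- apply: two_closed_mem clG _ => a b; rewrite !permE.
  have [/hE eqh | prodN] := dichN a b.
    by exists (h a); rewrite ?eqh // -?eqh (subsetP sNG).
  (* Factor [h a * (h b)^-1 = u * v] with [u] fixing [a] and [v] fixing [b]. Then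
     [u^-1 * h a = v * h b] acts as [h a] on [a] and as [h b] on [b]. *)
  have /(subsetP prodN)/mulsgP[u v /setIP[Nu Cu] /setIP[Nv Cv] Euv] :
    h a * (h b)^-1 \in N by rewrite groupM ?groupV.
  exists (u^-1 * h a); first by rewrite (subsetP sNG) // groupM ?groupV.
  have Ev : u^-1 * h a = v * h b.
    by rewrite -(mulgKV (h b) (h a)) Euv !mulgA mulVg mul1g.
  split; first by rewrite permM; move/groupVr/astab1P: Cu; rewrite /= /aperm => ->.
  by rewrite Ev permM; move/astab1P: Cv; rewrite /= /aperm => ->.
- suff -> : #[g] = p by [].
  apply: nt_prime_order => //.
    by apply/permP=> w; rewrite gX (abelemP p_pr abelN).2 ?perm1.
  by apply: contraNneq (fixg w0) => ->; rewrite perm1.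
- by apply/setP=> w; rewrite !inE sub1set inE /= /aperm (negPf (fixg w)).
Qed.

(** An element of order [p] has a number of fixed points congruent to [#|T|], so to 0, modulo [p];
    elusiveness makes this number positive. *)
Lemma prime_dvd_elusive_fixity G f p :
  elusive G -> has_fixity G f -> prime p -> p %| #|T| -> 0 < #|T| -> p <= f.
Proof.
move=> [trG elG] [fixG _] p_pr pT T0.
have pG : p %| #|G|.
  have /card_gt0P[w _] := T0.
  apply: dvdn_trans pT _; rewrite -cardsT -(atransP trG w) ?inE //.
  by rewrite card_orbit dvdn_indexg.
have [g Gg og] := Cauchy p_pr pG.
have ntg : g != 1 by rewrite -order_gt1 og prime_gt1.
apply: leq_trans (fixG g Gg ntg).
have pg : p.-group <[g]> by rewrite /pgroup -orderE og pnat_id.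
have actsT : [acts <[g]>, on [set: T] | 'P] by apply/actsP=> x _ y; rewrite !inE.
apply: dvdn_leq.
  rewrite card_gt0; apply/negP=> /eqP fix0; case: elG.
  by exists g; rewrite og.
have := pgroup_fix_mod pg actsT.
by rewrite afix_cycle setTI cardsT (eqnP pT) /dvdn => <-.
Qed.

(** Double count of the pairs [(x, w)] with [x] in [N] fixing [w]. *)
Lemma sum_card_fix N :
  \sum_(x in N) #|'Fix_'P[x]| = \sum_w #|'C_N[w | 'P]|.
Proof.
under eq_bigr do rewrite -sum1_card.
rewrite (exchange_big_dep xpredT) //=; apply: eq_bigr => w _.
rewrite -sum1_card; apply: eq_bigl => x; rewrite in_setI.
by congr (_ && _); apply/afix1P/astab1P.
Qed.

End SmallFixity.

Lemma prime_index_mul (gT : finGroupType) (N A B : {group gT}) :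
    abelian N -> A \subset N -> B \subset N -> prime #|N : A| ->
  B \subset A \/ A * B = N.
Proof.
move=> abN sAN sBN idx; have [sBA|nsBA] := boolP (B \subset A); [by left | right].
apply: mulg_normal_maximal => //; last exact: p_index_maximal.
by rewrite -(sub_abelian_normal A abN).
Qed.

Theorem corollary2p8 (Omega : finType) (G : {group {perm Omega}}) (f : nat) :
  solvable G -> elusive G -> two_closed G -> has_fixity G f -> 6 <= f.
Proof.
move=> solG elG clG fixf; rewrite leqNgt; apply/negP=> f5.
have [trG elG'] := elG; have [leF [z [Gz nz _]]] := fixf.
have ntG : G :!=: 1 by apply: contraNneq nz => G1; move: Gz; rewrite G1 inE.
have [N [sNG nNG ntN /is_abelemP[p p_pr abelN]]] :=
  solvable_norm_abelem solG (normal_refl G) ntG.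
have abN := abelem_abelian abelN.
have [w0 _] : exists w : Omega, z w != w.
  apply/existsP; apply: contraNT nz => /existsPn nfix.
  by apply/eqP/permP=> w; rewrite perm1; apply/eqP; move: (nfix w); rewrite negbK.
pose q := #|orbit 'P N w0|.
have CJ g w : g \in G -> 'C_N[g w | 'P] = 'C_N[w | 'P] :^ g.
  move=> Gg; have /= -> := astab1_act (perm_action Omega) w g.
  by rewrite [RHS]conjIg (normsP (normal_norm nNG) g Gg).
(* Transitivity of [G] and normality of [N] make all these stabilizers conjugate in [G]. *)
have cardC w : #|'C_N[w | 'P]| = #|'C_N[w0 | 'P]|.
  have : w \in orbit 'P G w0 by rewrite (atransP trG) ?inE.
  by case/orbitP=> g Gg <-; rewrite /= /aperm CJ // cardJg.
have Cq w : (q * #|'C_N[w | 'P]|)%N = #|N| by rewrite cardC card_orbit_stab.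
have orbq w : #|orbit 'P N w| = q.
  by apply/eqP; rewrite -(eqn_pmul2r (cardG_gt0 'C_N[w | 'P])) Cq card_orbit_stab.
have orbC a b : b \in orbit 'P N a -> 'C_N[b | 'P] = 'C_N[a | 'P].
  by case/orbitP=> x Nx <-; exact: astab1_abelian_act.
have fixC x w : x \in N -> (w \in 'Fix_'P[x]) = (x \in 'C_N[w | 'P]).
  by move=> Nx; rewrite in_setI Nx; apply/afix1P/astab1P.
have orbF x w : x \in 'C_N[w | 'P] -> orbit 'P N w \subset 'Fix_'P[x].
  move=> Cx; have Nx : x \in N by case/setIP: Cx.
  by apply/subsetP=> b /orbC Eb; rewrite fixC // Eb.
have fixN x : x \in N -> x != 1 -> exists w, x \in 'C_N[w | 'P].
  move=> Nx ntx; have /set0Pn[w Fw] : 'Fix_'P[x] != set0.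
    apply/negP=> /eqP F0; apply: elG'; exists x.
    by rewrite (subsetP sNG) // (abelem_order_p abelN).
  by exists w; rewrite -fixC.
have [x0 Nx0 ntx0] := trivgPn _ ntN.
have q_gt1 : 1 < q.
  rewrite ltnNge; apply: contraNN ntx0 => q_le1.
  apply/eqP/permP=> w; rewrite perm1.
  have /orbit1P/afixP : orbit 'P N w = [set w].
    apply/esym/eqP; rewrite eqEcard sub1set orbit_refl cards1.
    by rewrite (leq_trans _ q_le1) ?orbq.
  exact.
have ntNC w : ~~ (N \subset 'C[w | 'P]).
  apply/negP=> /setIidPl NC; move: (Cq w) q_gt1; rewrite NC.
  by move/eqP; rewrite -{2}[#|N|]mul1n eqn_pmul2r // => /eqP->.
have leFix x : x \in N -> x != 1 -> #|'Fix_'P[x]| <= 5.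
  move=> Nx ntx; rewrite -ltnS; apply: leq_ltn_trans f5.
  by apply: leF ntx; apply: (subsetP sNG).
have q_le5 : q <= 5.
  have [w Cw] := fixN x0 Nx0 ntx0.
  by rewrite -(orbq w) (leq_trans (subset_leq_card (orbF _ _ Cw))) ?leFix.
have [] := two_closed_derangement clG sNG p_pr abelN ntNC _ w0; last first.
  by move=> g derg; apply: elG'; exists g.
move=> a b; have [q4 | q_neq4] := eqVneq q 4; last first.
  have q_pr : prime q.
    by move: q_gt1 q_le5 q_neq4; case: (q) => [|[|[|[|[|[]]]]]].
  have idx : prime #|N : 'C_N[a | 'P]| by rewrite -card_orbit orbq.
  have [sba|->] := prime_index_mul abN (subsetIl _ _) (subsetIl N 'C[b | 'P]) idx.
    by left; apply/eqP; rewrite eq_sym eqEcard sba !cardC leqnn.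
  by right.
have [ab | nab] := boolP (b \in orbit 'P N a); first by left; rewrite (orbC _ _ ab).
right.
(* Fixing two distinct orbits of size 4 would give at least 8 fixed points, more than 5. *)
have uniqF x c d : x \in 'C_N[c | 'P] -> x \in 'C_N[d | 'P] -> x != 1 ->
  d \in orbit 'P N c.
  move=> Cc Cd ntx; have Nx : x \in N by case/setIP: Cc.
  apply: contraT => ndc; have := leFix x Nx ntx; rewrite leqNgt => /negP[].
  have dis : [disjoint orbit 'P N c & orbit 'P N d].
    rewrite -setI_eq0; apply/eqP/setP=> e; rewrite !inE; apply: contraNF ndc.
    by case/andP=> /orbit_eqP ec /orbit_eqP ed; rewrite -ec ed orbit_refl.
  apply: (@leq_trans #|orbit 'P N c :|: orbit 'P N d|).
    by rewrite cardsU disjoint_setI0 // cards0 subn0 !orbq q4.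
  by rewrite subset_leq_card // subUset !orbF.
have TI : 'C_N[a | 'P] :&: 'C_N[b | 'P] = 1.
  apply/trivgP/subsetP=> x /setIP[Ca Cb]; rewrite inE.
  by apply: contraNT nab => ntx; apply: uniqF ntx.
have sCN : 'C_N[a | 'P] * 'C_N[b | 'P] \subset N by rewrite mul_subG ?subsetIl.
have cardAB : #|'C_N[a | 'P] * 'C_N[b | 'P]| = (#|'C_N[w0 | 'P]| ^ 2)%N.
  by rewrite TI_cardMg // !cardC.
set c := #|'C_N[w0 | 'P]| in cardC cardAB.
have cardN : #|N| = (4 * c)%N by rewrite -q4 -(Cq w0) cardC.
have pN r : prime r -> r %| 4 * c -> r = p.
  by rewrite -cardN => r_pr /(pgroupP (abelem_pgroup abelN) _ r_pr)/eqP.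
(* The product of the two stabilizers has [c ^ 2] elements inside [N], of order [4 * c]. *)
have c_le4 : c <= 4.
  have := subset_leq_card sCN; rewrite cardAB cardN expnS expn1 leq_pmul2r //.
  exact: cardG_gt0.
have c_gt1 : 1 < c.
  have [w Cw] := fixN x0 Nx0 ntx0; rewrite -(cardC w) cardG_gt1.
  by apply/trivgPn; exists x0.
(* Otherwise [N] would be a [p]-group of order 12. *)
have c_neq3 : c != 3.
  by apply/eqP=> c3; have := pN 3; rewrite -(pN 2) // c3 // => /(_ isT isT).
(* Here [#|N| = 8], and [sum_card_fix] reads [#|Omega| + 7 * 4 = 2 * #|Omega|]: the seven nontrivial
   elements fix one orbit each. So 7 divides [#|Omega|], forcing [7 <= f]. *)
have c_neq2 : c != 2.
  apply/eqP=> c2; suff o28 : #|Omega| = 28.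
    have := prime_dvd_elusive_fixity (p := 7) elG fixf; rewrite o28.
    by move/(_ isT isT isT) => f7; have := leq_trans f7 (ltnW f5).
  have := sum_card_fix N.
  have card_fix1 : #|'Fix_'P[1 : {perm Omega}]| = #|Omega|.
    by rewrite -cardsT; apply: eq_card => w; rewrite [RHS]inE; apply/afix1P/act1.
  rewrite (bigD1 1) ?group1 //= card_fix1 (eq_bigr (fun=> 4)); last first.
    move=> x /andP[Nx ntx]; have [w Cw] := fixN x Nx ntx.
    rewrite -q4 -(orbq w); apply/eq_card/subset_eqP/andP; split; last exact: orbF.
    by apply/subsetP=> d; rewrite fixC // => Cd; apply: uniqF ntx.
  rewrite sum_nat_const (eq_bigr (fun=> c)) // sum_nat_const c2.
  have := cardsD1 1 N; rewrite group1 cardN c2.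
  have -> : #|N :\ 1| = #|[pred x in N | x != 1]|.
    by apply: eq_card => x; rewrite !inE andbC.
  case; rewrite add0n => <-; move/eqP.
  by rewrite [(#|xpredT| * 2)%N]muln2 -addnn eqn_add2l => /eqP <-.
have c4 : c = 4 by case: (c) c_gt1 c_le4 c_neq2 c_neq3 => [|[|[|[|[]]]]].
suff /eqP-> : 'C_N[a | 'P] * 'C_N[b | 'P] == N by [].
by rewrite eqEcard sCN cardAB cardN c4.
Qed.
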